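(* For any star $K_{1,n-1}$ of order $n\ge 2$ and any $ec$-partition $\pi$ of $K_{1,n-1}$, $$ECG(K_{1,n-1},\pi)\simeq (n-1)K_1,$$ where $(n-1)K_1$ is the graph consisting of $n-1$ isolated vertices.
   Context: Graphs are finite and simple. Two distinct edges are adjacent if they share an endpoint. A set $D\subseteq E$ is an edge-dominating set of $G=(V,E)$ if every edge in $E\setminus D$ is adjacent to an edge of $D$. Two disjoint sets of edges $E_1,E_2$ form an edge coalition if neither is an edge-dominating set but $E_1\cup E_2$ is. An $ec$-partition of $G$ is a partition $\pi=\{E_1,\ldots,E_k\}$ of $E$ into nonempty sets such that every $E_i$ is either a singleton edge-dominating set, or is not an edge-dominating set but forms an edge coalition with another set $E_j$ of $\pi$. For an $ec$-partition $\pi$ of $G$, the edge coalition graph $ECG(G,\pi)$ is the graph whose vertices are the sets of $\pi$, two vertices being adjacent if and only if the corresponding sets form an edge coalition in $G$. *)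

(* Defs.v *)
From HB Require Import structures.
From mathcomp Require Import all_boot.

Set Implicit Arguments.
Unset Strict Implicit.
Unset Printing Implicit Defensive.

Record sgraph := SGraph {
  vertex :> finType;
  adj : rel vertex;
  adj_sym : symmetric adj;
  adj_irrefl : irreflexive adj }.

Definition isomorphic (G H : sgraph) : Prop :=
  exists2 f : G -> H, bijective f & forall x y, adj (f x) (f y) = adj x y.

(* The edge joining x and y is the two-element set [set x; y]. *)
Definition edges (G : sgraph) : {set {set G}} :=
  [set [set x; y] | x in [set: G], y in adj x].

Definition adj_edges (G : sgraph) (e f : {set G}) : bool :=
  (e != f) && ~~ [disjoint e & f].

Definition edge_dominating (G : sgraph) (D : {set {set G}}) : bool :=
  (D \subset edges G) &&
  [forall e in edges G :\: D, exists d in D, adj_edges e d].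

Definition edge_coalition (G : sgraph) (A B : {set {set G}}) : bool :=
  [&& A \subset edges G, B \subset edges G, [disjoint A & B],
      ~~ edge_dominating A, ~~ edge_dominating B
    & edge_dominating (A :|: B)].

Definition ec_partition (G : sgraph) (pi : {set {set {set G}}}) : bool :=
  partition pi (edges G) &&
  [forall A in pi,
     (#|A| == 1) && edge_dominating A
     || ~~ edge_dominating A && [exists B in pi :\ A, edge_coalition A B]].

Lemma edge_coalition_sym (G : sgraph) : symmetric (@edge_coalition G).
Proof.
by move=> A B; rewrite /edge_coalition setUC disjoint_sym; do !bool_congr.
Qed.

Lemma edge_coalition_irrefl (G : sgraph) : irreflexive (@edge_coalition G).
Proof.
by move=> A; rewrite /edge_coalition setUid andNb !andbF.
Qed.

Section EdgeCoalitionGraph.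
Variables (G : sgraph) (pi : {set {set {set G}}}).

Definition ECG_adj : rel {A : {set {set G}} | A \in pi} :=
  fun A B => edge_coalition (val A) (val B).

Fact ECG_adj_sym : symmetric ECG_adj.
Proof. by move=> A B; apply: edge_coalition_sym. Qed.

Fact ECG_adj_irrefl : irreflexive ECG_adj.
Proof. by move=> A; apply: edge_coalition_irrefl. Qed.

(* Defined for every family pi of edge sets; only meant for ec-partitions. *)
Definition ECG : sgraph := SGraph ECG_adj_sym ECG_adj_irrefl.

End EdgeCoalitionGraph.

Section CompleteBipartite.
Variables p q : nat.

Definition complete_bipartite_adj : rel ('I_p + 'I_q)%type :=
  fun x y => match x, y with
             | inl _, inr _ | inr _, inl _ => true
             | _, _ => false
             end.

Fact complete_bipartite_adj_sym : symmetric complete_bipartite_adj.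
Proof. by case=> x [] y. Qed.

Fact complete_bipartite_adj_irrefl : irreflexive complete_bipartite_adj.
Proof. by case. Qed.

Definition complete_bipartite : sgraph :=
  SGraph complete_bipartite_adj_sym complete_bipartite_adj_irrefl.

End CompleteBipartite.

Section Edgeless.
Variable m : nat.

Definition edgeless_adj : rel 'I_m := fun _ _ => false.

Fact edgeless_adj_sym : symmetric edgeless_adj. Proof. by []. Qed.

Fact edgeless_adj_irrefl : irreflexive edgeless_adj. Proof. by []. Qed.

(* The disjoint union m K_1 of m isolated vertices. *)
Definition edgeless : sgraph := SGraph edgeless_adj_sym edgeless_adj_irrefl.

End Edgeless.

(* Main.v *)
Require Import Defs.
From mathcomp Require Import all_boot.

(** All edges of a star contain its centre, so any two of them meet and every
nonempty set of edges is edge-dominating (nonempty_edge_dominating).  The sets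
of an ec-partition are nonempty, hence none of them can be in an edge
coalition, and each must be a singleton.  The partition therefore has as many
sets as the graph has edges, and its coalition graph has no edge
(ECG_intersecting).  This much holds whenever the edges pairwise meet; for the
star it remains to count its edges, one for each leaf (card_edges_star). *)

Definition intersecting_edges (G : sgraph) : Prop :=
  {in edges G &, forall e f : {set G}, ~~ [disjoint e & f]}.

(** Any member of D already meets every other edge, so it dominates all the
edges outside D on its own. *)
Lemma nonempty_edge_dominating (G : sgraph) (D : {set {set G}}) :
  intersecting_edges G -> D \subset edges G -> D != set0 -> edge_dominating D.
Proof.
move=> meetG sDG /set0Pn[d Dd]; rewrite /edge_dominating sDG /=.
apply/forall_inP => e /setDP[Ge D'e]; apply/existsP; exists d.
rewrite Dd /adj_edges (meetG e d Ge (subsetP sDG d Dd)) andbT.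
by apply: contraNneq D'e => ->.
Qed.

Lemma ec_partition_dominating (G : sgraph) (pi : {set {set {set G}}}) A :
  intersecting_edges G -> ec_partition pi -> A \in pi -> edge_dominating A.
Proof.
move=> meetG /andP[part_pi _] piA; apply: nonempty_edge_dominating => //.
  by rewrite -(cover_partition part_pi); apply: bigcup_sup.
by apply: contraTneq piA => ->; have /and3P[] := part_pi.
Qed.

(** A set of an ec-partition that is edge-dominating must be a singleton, and
here all of them are, so the partition is the finest one. *)
Lemma card_ec_partition_intersecting (G : sgraph) (pi : {set {set {set G}}}) :
  intersecting_edges G -> ec_partition pi -> #|pi| = #|edges G|.
Proof.
move=> meetG ec_pi; have /andP[part_pi /forall_inP ec_sets] := ec_pi.
rewrite -[LHS]muln1; apply: esym.
apply: card_uniform_partition part_pi => A piA.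
have domA := ec_partition_dominating _ _ _ meetG ec_pi piA.
by have := ec_sets A piA; rewrite domA andbT orbF => /eqP.
Qed.

Lemma isomorphic_edgeless (G : sgraph) (m : nat) :
  #|G| = m -> (forall x y : G, adj x y = false) -> isomorphic G (edgeless m).
Proof.
move=> cardG adjG0.
exists (cast_ord cardG \o enum_rank) => [|x y].
  apply: bij_comp; last exact: enum_rank_bij.
  by exists (cast_ord (esym cardG)); [apply: cast_ordK | apply: cast_ordKV].
by rewrite adjG0.
Qed.

(** Edge coalitions are formed by sets that are not edge-dominating, and an
ec-partition of G contains none. *)
Lemma ECG_intersecting (G : sgraph) (pi : {set {set {set G}}}) :
  intersecting_edges G -> ec_partition pi ->
  isomorphic (ECG pi) (edgeless #|edges G|).
Proof.
move=> meetG ec_pi; apply: isomorphic_edgeless => [|A B].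
  by rewrite /= card_sig -(card_ec_partition_intersecting _ _ meetG ec_pi).
rewrite /= /ECG_adj /edge_coalition.
by rewrite (ec_partition_dominating _ _ _ meetG ec_pi (valP A)) /= !andbF.
Qed.

Section StarEdges.
Variable m : nat.
Local Notation star := (complete_bipartite 1 m).

Definition star_edge (j : 'I_m) : {set star} := [set inl ord0; inr j].

Lemma edges_starE : edges star = [set star_edge j | j : 'I_m].
Proof.
apply/setP=> e; apply/imset2P/imsetP => [[x y _ xy ->] | [j _ ->]].
  case: x y xy => [i|j] [i'|j'] // _.
    by exists j'; rewrite // /star_edge (ord1 i).
  by exists j; rewrite // /star_edge setUC (ord1 i').
by exists (inl ord0) (inr j).
Qed.

Lemma star_edge_inj : injective star_edge.
Proof.
move=> j k /setP/(_ (inr j)); rewrite !inE eqxx orbT /= => /esym/eqP.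
by case.
Qed.

Lemma card_edges_star : #|edges star| = m.
Proof. by rewrite edges_starE card_imset ?card_ord //; apply: star_edge_inj. Qed.

Lemma star_intersecting_edges : intersecting_edges star.
Proof.
move=> e f; rewrite edges_starE => /imsetP[j _ ->] /imsetP[k _ ->].
by apply/pred0Pn; exists (inl ord0); rewrite /= !inE eqxx.
Qed.

End StarEdges.

Theorem theorem7p2 (n : nat) (n_ge2 : 2 <= n)
    (pi : {set {set {set complete_bipartite 1 (n - 1)}}})
    (ec_pi : ec_partition pi) :
  isomorphic (ECG pi) (edgeless (n - 1)).
Proof.
have := ECG_intersecting _ _ (star_intersecting_edges (n - 1)) ec_pi.
by rewrite card_edges_star.
Qed.
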